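(* Consider the iterative procedure DR-RC-Iterative-MPC (defined in the context), initialized with a sampled-safe-set $\mathcal{S}^0$ that contains the states of a finite-length robustly safe trajectory from $x_S$ to $x_F$ (initialization assumption in the context). Then, for each iteration $j\ge1$ of the procedure, the trajectory $(\mathsf{x}^j,\mathsf{u}^j)$ generated by the routine $\mathrm{DR\_MPC}$ satisfies $x_t^j\to x_F$ as $t\to\infty$.
   Context: Notation: $\mathbb{N}=\{0,1,2,\dots\}$, $[z]_+=\max(z,0)$. For a random variable $Z$ with distribution $\mu$ and $\beta\in(0,1)$, $\mathrm{CVaR}_\beta^{\mu}[Z]=\inf_{s\in\mathbb{R}}\{s+\beta^{-1}\mathbb{E}^{\mu}[Z-s]_+\}$. Problem data. The system is $x_{t+1}=f(x_t,u_t)$ with $f:\mathbb{R}^{n_x}\times\mathbb{R}^{n_u}\to\mathbb{R}^{n_x}$; states and inputs are constrained to compact sets $\mathcal{X}\subset\mathbb{R}^{n_x}$, $\mathcal{U}\subset\mathbb{R}^{n_u}$. $x_S\in\mathcal{X}$ is the initial state and $x_F\in\mathcal{X}$ the target equilibrium, i.e. $0\in\mathcal{U}$ and $f(x_F,0)=x_F$. The stage cost $r:\mathcal{X}\times\mathcal{U}\to[0,\infty)$ is continuous, $r(x_F,0)=0$ and $r(x,u)>0$ for $(x,u)\ne(x_F,0)$. $w$ is a random variable supported on a compact set $\mathcal{W}\subset\mathbb{R}^{n_w}$; $g:\mathcal{X}\times\mathcal{W}\to\mathbb{R}$ is continuous; $\delta>0$, $\beta\in(0,1)$ and the horizon $K\in\mathbb{N}$,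 $K\ge1$, are given. Ambiguity sets. $\mathbb{D}$ is a map assigning to each finite dataset of samples from $\mathcal{W}$ a closed nonempty set of probability distributions supported on $\mathcal{W}$. With $\widehat{\mathcal{W}}^{j}$ the dataset of i.i.d. samples of $w$ available at the end of iteration $j$ (with $\widehat{\mathcal{W}}^{0}$ given initially, and one sample per time-step added during each iteration), set $\mathcal{D}^{j}=\mathbb{D}(\widehat{\mathcal{W}}^{j})$. Sampled-safe-sets. A sampled-safe-set is a finite set $\mathcal{S}\subset\mathbb{N}\times\mathcal{X}\times[0,\infty)$ of triples (trajectory index $i$, state $x$, cost-to-go $J$). $\Pi_{\mathrm{state}}(\mathcal{S})$ is the set of states appearing in it. Its minimum cost-to-go is $Q_{\mathcal{S}}(x)=\min\{J:(i,x,J)\in\mathcal{S}\}$ for $x\in\Pi_{\mathrm{state}}(\mathcal{S})$, and $+\infty$ otherwise. Finite-horizon problem. For a state $x$, sampled-safe-set $\overline{\mathcal{S}}$ and ambiguity set $\overline{\mathcal{D}}$, $\mathrm{FH}(x;\overline{\mathcal{S}},\overline{\mathcal{D}})$ is: minimize $\sum_{k=0}^{K-1}r(x_k,u_k)+Q_{\overline{\mathcal{S}}}(x_K)$ over $(x_0,\dots,x_K)$, $(u_0,\dots,u_{K-1})$ subject to $x_0=x$; $x_{k+1}=f(x_k,u_k)$, $x_k\in\mathcal{X}$, $u_k\in\mathcal{U}$, $\sup_{\mu\in\overline{\mathcal{D}}}\mathrm{CVaR}_\beta^{\mu}[g(x_k,w)]\le\delta$ for all $k=0,\dots,K-1$;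 and $x_K\in\Pi_{\mathrm{state}}(\overline{\mathcal{S}})$. Whenever it is feasible, the minimum is taken to be attained. Routine $\mathrm{DR\_MPC}(\overline{\mathcal{S}},\overline{\mathcal{D}})$: start with $t=0$, $x_0=x_S$. While $x_t\ne x_F$: solve $\mathrm{FH}(x_t;\overline{\mathcal{S}},\overline{\mathcal{D}})$, let $u_t$ be the first input of an optimizer, set $x_{t+1}=f(x_t,u_t)$, and increase $t$ by one. Return the state and input sequences. If $x_F$ is reached, the state stays at $x_F$ with zero input at all later times; if the loop does not terminate, the trajectory is the resulting infinite sequence. DR-RC-Iterative-MPC: for $j=1,2,\dots$: (1) $(\mathsf{x}^j,\mathsf{u}^j)=\mathrm{DR\_MPC}(\mathcal{S}^{j-1},\mathcal{D}^{j-1})$, with states $x_t^j$, inputs $u_t^j$ and length $T_j$; (2) $\widehat{\mathcal{W}}^{j}$ is $\widehat{\mathcal{W}}^{j-1}$ with the $T_j$ new samples added, $\mathcal{D}^j=\mathbb{D}(\widehat{\mathcal{W}}^j)$; (3) form $\tilde{\mathcal{S}}=\mathcal{S}^{j-1}\cup\{(j,x_t^j,J^j_{(t:\infty)})\}_{t=1}^{T_j}$, where $J^j_{(t:\infty)}=\sum_{k=t}^{\infty}r(x_k^j,u_k^j)$; (4) $\mathcal{S}^j$ is obtained from $\tilde{\mathcal{S}}$ by deleting all triples of every trajectory index $i$ for which some $(i,x,J)\in\tilde{\mathcal{S}}$ has $\sup_{\mu\in\mathcal{D}^j}\mathrm{CVaR}_\beta^{\mu}[g(x,w)]>\delta$.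 Standing assumption: the trajectories of completed iterations (those used to build the sampled-safe-sets) have finite length, ending at $x_F$. Initialization assumption: $\mathcal{S}^0$ consists of the triples (index $0$, state, cost-to-go) for the states of a finite-length trajectory of the system, generated by inputs in $\mathcal{U}$, that starts at $x_S$ and reaches $x_F$, and is robustly safe: $x\in\mathcal{X}$ and $g(x,w)\le\delta$ for all $w\in\mathcal{W}$ and all $x\in\Pi_{\mathrm{state}}(\mathcal{S}^0)$. *)

(* Defs.v *)
From HB Require Import structures.
From mathcomp Require Import all_boot all_order all_algebra finmap.
From mathcomp Require Import all_classical all_reals all_analysis.

Set Implicit Arguments.
Unset Strict Implicit.
Unset Printing Implicit Defensive.

Import Order.TTheory GRing.Theory Num.Theory.
Import numFieldNormedType.Exports.

Local Open Scope classical_set_scope.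
Local Open Scope ring_scope.

(* R^n with its Borel sigma-algebra; the carrier is convertible to 'rV[R]_n. *)
Notation borel_rV R n := (g_sigma_algebraType (@open 'rV[R]_n)).

(* CVaR_beta^mu[Z] = inf_s (s + beta^-1 E^mu[(Z - s)_+]), as an extended real. *)
Definition cvar {d} {T : measurableType d} {R : realType} (beta : R)
    (mu : probability T R) (Z : T -> R) : \bar R :=
  ereal_inf [set (s%:E + (beta^-1)%:E * 'E_mu[fun w => Num.max (Z w - s)%R 0%R])%E
            | s in [set: R]].

(* Closedness for the topology of weak convergence of probability measures
   (the initial topology of the maps mu |-> E^mu[h], h bounded continuous),
   phrased with filters: every weak limit of a filter living on D is in D. *)
Definition weakly_closed (R : realType) (n : nat)
    (D : set (probability (borel_rV R n) R)) : Prop :=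
  forall (F : set_system (probability (borel_rV R n) R))
         (mu : probability (borel_rV R n) R),
    ProperFilter F -> F D ->
    (forall h : 'rV[R]_n -> R, continuous h -> bounded_fun h ->
       (fun nu : probability (borel_rV R n) R => 'E_nu[h]%E) @ F --> 'E_mu[h]%E) ->
    D mu.

Definition ambiguity_set (R : realType) (n : nat) (W : set 'rV[R]_n)
    (D : set (probability (borel_rV R n) R)) : Prop :=
  [/\ weakly_closed D, D !=set0 & forall mu, D mu -> mu W = 1%E].

Definition mutually_independent {d d'} {Omega : measurableType d}
    {T : measurableType d'} {R : realType} (P : probability Omega R)
    (xi : nat -> Omega -> T) : Prop :=
  forall (I : {fset nat}) (A : nat -> set T), (forall i, measurable (A i)) ->
    P (\bigcap_(i in [set` I]) (xi i @^-1` A i)) =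
    (\prod_(i <- I) P (xi i @^-1` A i))%E.

Definition same_law {d d'} {Omega : measurableType d}
    {T : measurableType d'} {R : realType} (P : probability Omega R)
    (X Y : Omega -> T) : Prop :=
  forall A : set T, measurable A -> P (X @^-1` A) = P (Y @^-1` A).

(* The random variable w has support in W, and xi 0, xi 1, ... are i.i.d.
   samples of it. *)
Definition iid_samples {d} {Omega : measurableType d} {R : realType} (n : nat)
    (W : set 'rV[R]_n) (P : probability Omega R)
    (w : Omega -> borel_rV R n) (xi : nat -> Omega -> borel_rV R n) : Prop :=
  [/\ measurable_fun [set: Omega] w, P (w @^-1` W) = 1%E,
      forall i, measurable_fun [set: Omega] (xi i),
      forall i, same_law P (xi i) w &
      mutually_independent P xi].

(* Functions whose natural domain is X * U or X * W are total here; only their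
   values on that domain are constrained, or ever used.  A dataset is the
   list of its samples. *)
Record mpc_problem (R : realType) (nx nu nw : nat) := MPCProblem {
  dyn : 'rV[R]_nx -> 'rV[R]_nu -> 'rV[R]_nx;
  stX : set 'rV[R]_nx;
  inU : set 'rV[R]_nu;
  xS : 'rV[R]_nx;
  xF : 'rV[R]_nx;
  cost : 'rV[R]_nx -> 'rV[R]_nu -> R;
  supW : set 'rV[R]_nw;
  risk : 'rV[R]_nx -> 'rV[R]_nw -> R;
  delta : R;
  beta : R;
  horizon : nat;
  ambig : seq 'rV[R]_nw -> set (probability (borel_rV R nw) R);

  stX_compact : compact stX;
  inU_compact : compact inU;
  supW_compact : compact supW;
  xS_in : stX xS;
  xF_in : stX xF;
  zero_in : inU 0;
  xF_equilibrium : dyn xF 0 = xF;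
  cost_continuous :
    {within stX `*` inU, continuous (fun z : 'rV[R]_nx * 'rV[R]_nu => cost z.1 z.2)};
  cost_ge0 : forall x u, stX x -> inU u -> 0 <= cost x u;
  cost_xF : cost xF 0 = 0;
  cost_gt0 : forall x u, stX x -> inU u -> (x, u) <> (xF, 0) -> 0 < cost x u;
  risk_continuous :
    {within stX `*` supW, continuous (fun z : 'rV[R]_nx * 'rV[R]_nw => risk z.1 z.2)};
  delta_gt0 : 0 < delta;
  beta_gt0 : 0 < beta;
  beta_lt1 : beta < 1;
  horizon_gt0 : (0 < horizon)%N;
  ambigP : forall s : seq 'rV[R]_nw,
    (forall w, w \in s -> supW w) -> ambiguity_set supW (ambig s)
}.

(* A triple (i, x, J): trajectory index, state, cost-to-go. *)
Notation triple R n := (nat * 'rV[R]_n * R)%type.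

Definition sampled_safe_set (R : realType) (nx nu nw : nat)
    (pb : mpc_problem R nx nu nw) (S : set (triple R nx)) : Prop :=
  finite_set S /\ (forall i x J, S (i, x, J) -> stX pb x /\ 0 <= J).

Definition states (R : realType) (n : nat) (S : set (triple R n))
    : set 'rV[R]_n :=
  [set x | exists i J, S (i, x, J)].

(* For finite S the infimum is a minimum, and ereal_inf set0 = +oo covers the
   states that do not appear in S. *)
Definition min_cost_to_go (R : realType) (n : nat) (S : set (triple R n))
    (x : 'rV[R]_n) : \bar R :=
  ereal_inf [set J%:E | J in [set J | exists i, S (i, x, J)]].

(* sup_(mu in D) CVaR_beta^mu[g(x, w)].  Each mu is concentrated on W, outside
   of which g(x, .) is replaced by 0. *)
Definition worst_cvar (R : realType) (nx nu nw : nat)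
    (pb : mpc_problem R nx nu nw)
    (D : set (probability (borel_rV R nw) R)) (x : 'rV[R]_nx) : \bar R :=
  ereal_sup [set cvar (beta pb) mu (risk pb x \_ (supW pb)) | mu in D].

(* Only xs 0, ..., xs K and us 0, ..., us (K - 1) matter. *)
Definition fh_feasible (R : realType) (nx nu nw : nat)
    (pb : mpc_problem R nx nu nw) (x : 'rV[R]_nx) (S : set (triple R nx))
    (D : set (probability (borel_rV R nw) R))
    (xs : nat -> 'rV[R]_nx) (us : nat -> 'rV[R]_nu) : Prop :=
  [/\ xs 0%N = x,
      forall k, (k < horizon pb)%N ->
        [/\ xs k.+1 = dyn pb (xs k) (us k), stX pb (xs k), inU pb (us k) &
            (worst_cvar pb D (xs k) <= (delta pb)%:E)%E] &
      states S (xs (horizon pb))].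

Definition fh_cost (R : realType) (nx nu nw : nat)
    (pb : mpc_problem R nx nu nw) (S : set (triple R nx))
    (xs : nat -> 'rV[R]_nx) (us : nat -> 'rV[R]_nu) : \bar R :=
  ((\sum_(0 <= k < horizon pb) cost pb (xs k) (us k))%:E
   + min_cost_to_go S (xs (horizon pb)))%E.

Definition fh_optimal (R : realType) (nx nu nw : nat)
    (pb : mpc_problem R nx nu nw) (x : 'rV[R]_nx) (S : set (triple R nx))
    (D : set (probability (borel_rV R nw) R))
    (xs : nat -> 'rV[R]_nx) (us : nat -> 'rV[R]_nu) : Prop :=
  fh_feasible pb x S D xs us /\
  forall xs' us', fh_feasible pb x S D xs' us' ->
    (fh_cost pb S xs us <= fh_cost pb S xs' us')%E.

Definition fh_attained (R : realType) (nx nu nw : nat)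
    (pb : mpc_problem R nx nu nw) : Prop :=
  forall (x : 'rV[R]_nx) (S : set (triple R nx))
         (D : set (probability (borel_rV R nw) R)),
    stX pb x -> sampled_safe_set pb S -> ambiguity_set (supW pb) D ->
    (exists xs us, fh_feasible pb x S D xs us) ->
    exists xs us, fh_optimal pb x S D xs us.

Definition fh_first_input (R : realType) (nx nu nw : nat)
    (pb : mpc_problem R nx nu nw) (x : 'rV[R]_nx) (S : set (triple R nx))
    (D : set (probability (borel_rV R nw) R)) (u : 'rV[R]_nu) : Prop :=
  exists xs us, fh_optimal pb x S D xs us /\ us 0%N = u.

(* (x, u) is an output of DR_MPC(S, D), prolonged for ever by x_F and zero
   inputs once x_F is reached.  Recursive feasibility is not presupposed: if
   FH(x_t; S, D) has no optimizer, then u_t is unconstrained. *)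
Definition dr_mpc (R : realType) (nx nu nw : nat)
    (pb : mpc_problem R nx nu nw) (S : set (triple R nx))
    (D : set (probability (borel_rV R nw) R))
    (x : nat -> 'rV[R]_nx) (u : nat -> 'rV[R]_nu) : Prop :=
  x 0%N = xS pb /\
  forall t,
    [/\ x t.+1 = dyn pb (x t) (u t),
        x t = xF pb -> u t = 0 &
        x t <> xF pb -> (exists v, fh_first_input pb (x t) S D v) ->
          fh_first_input pb (x t) S D (u t)].

(* J_(t:oo); only used for trajectories that stay at x_F, with zero input, from
   some time on, so that the series is a finite sum. *)
Definition cost_to_go (R : realType) (nx nu nw : nat)
    (pb : mpc_problem R nx nu nw)
    (x : nat -> 'rV[R]_nx) (u : nat -> 'rV[R]_nu) (t : nat) : R :=
  limn (fun n => \sum_(t <= k < n) cost pb (x k) (u k)).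

Definition initial_safe_set (R : realType) (nx nu nw : nat)
    (pb : mpc_problem R nx nu nw) (S : set (triple R nx)) : Prop :=
  exists (x : nat -> 'rV[R]_nx) (u : nat -> 'rV[R]_nu) (T : nat),
    [/\ x 0%N = xS pb,
        forall t, (t < T)%N -> x t.+1 = dyn pb (x t) (u t) /\ inU pb (u t),
        forall t, (T <= t)%N -> x t = xF pb /\ u t = 0,
        S = [set (0%N, x t, cost_to_go pb x u t) | t in [set t | (t <= T)%N]] &
        forall y, states S y ->
          stX pb y /\ forall w, supW pb w -> risk pb y w <= delta pb].

Definition reaches_at (R : realType) (nx nu nw : nat)
    (pb : mpc_problem R nx nu nw) (x : nat -> 'rV[R]_nx) (T : nat) : Prop :=
  x T = xF pb /\ forall t, (t < T)%N -> x t <> xF pb.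

Definition add_trajectory (R : realType) (nx nu nw : nat)
    (pb : mpc_problem R nx nu nw) (S : set (triple R nx)) (j : nat)
    (x : nat -> 'rV[R]_nx) (u : nat -> 'rV[R]_nu) (T : nat)
    : set (triple R nx) :=
  S `|` [set (j, x t, cost_to_go pb x u t) | t in [set t | (1 <= t <= T)%N]].

Definition delete_unsafe (R : realType) (nx nu nw : nat)
    (pb : mpc_problem R nx nu nw) (S : set (triple R nx))
    (D : set (probability (borel_rV R nw) R)) : set (triple R nx) :=
  [set p | S p /\
     ~ exists y J, S (p.1.1, y, J) /\ ((delta pb)%:E < worst_cvar pb D y)%E].

(* An execution of DR-RC-Iterative-MPC up to and including the run of DR_MPC in
   iteration j: iterations i < j are completed, so they have a finite length
   T i, while the run of iteration j may be infinite.  The dataset at the end of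
   iteration i consists of the first m i terms of the stream xi of samples.  The
   values at indices beyond those mentioned are irrelevant. *)
Record dr_rc_iterative_mpc (R : realType) (nx nu nw : nat)
    (pb : mpc_problem R nx nu nw) (xi : nat -> 'rV[R]_nw) (m0 : nat)
    (S0 : set (triple R nx)) (j : nat)
    (x : nat -> nat -> 'rV[R]_nx) (u : nat -> nat -> 'rV[R]_nu)
    (T : nat -> nat) (m : nat -> nat) (S : nat -> set (triple R nx)) : Prop :=
  DRRCIterativeMPC {
    run_init : m 0%N = m0 /\ S 0%N = S0;
    run_mpc : forall i, (0 < i <= j)%N ->
      dr_mpc pb (S i.-1) (ambig pb (mkseq xi (m i.-1))) (x i) (u i);
    run_length : forall i, (0 < i < j)%N -> reaches_at pb (x i) (T i);
    run_data : forall i, (0 < i < j)%N -> m i = (m i.-1 + T i)%N;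
    run_safe_set : forall i, (0 < i < j)%N ->
      S i = delete_unsafe pb
              (add_trajectory pb (S i.-1) i (x i) (u i) (T i))
              (ambig pb (mkseq xi (m i)))
  }.

(* Main.v *)
Require Import Defs.
From HB Require Import structures.
From mathcomp Require Import all_boot all_order all_algebra finmap.
From mathcomp Require Import all_classical all_reals all_analysis.

Set Implicit Arguments.
Unset Strict Implicit.
Unset Printing Implicit Defensive.

Import Order.TTheory GRing.Theory Num.Theory.
Import numFieldNormedType.Exports.

Local Open Scope classical_set_scope.
Local Open Scope ring_scope.

(** Write V(y) for the optimal value of FH(y; S, D), with S and D fixed during
    one run of the routine.  The run converges because V is a Lyapunov function:

      cost(x_t, u_t) + V(x_(t+1)) <= V(x_t)      (fh_value_decrease).

    This comes from shifting an optimizer at x_t by one step (fh_shift).  Its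
    last state lies in S, and the trajectory of S that owns it prescribes one
    more input; the cost-to-go stored in S pays exactly for that extra step.
    The shifted trajectory also proves that the problem stays feasible.  Since
    V >= 0 and V(x_0) is finite, the stage costs along the run are summable and
    hence tend to 0.  The pairs (x_t, u_t) stay in the compact set X * U, on
    which the continuous stage cost vanishes only at (x_F, 0), so they converge
    to that point (compact_cvg_unique_level).

    The argument needs three properties of the pair (S, D), which form the
    predicate safe_and_closed: S is a sampled-safe-set, its states satisfy the
    risk constraint for D, and every triple of S has a successor in S with the
    same trajectory index (successor_closed).  It also needs FH to be feasible
    at x_S.  All of this holds at every iteration, by induction
    (iteration_safe_set): the new trajectory is closed under successors because
    it ends at the equilibrium x_F, where the cost-to-go is 0; deletion removes
    whole trajectories, so it keeps successors; and it never removes the initial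
    trajectory, whose robust safety bounds its worst-case CVaR by delta whatever
    the ambiguity set (worst_cvar_le_delta).  The initial trajectory itself is
    then feasible for FH at x_S.  The argument is pathwise: it concerns one fixed
    stream of samples in W. *)

(** * Convergence on compact sets and summable sequences *)

(** Away from an open neighbourhood V of p, the image of A is compact, hence
    closed, and misses y0; so f leaves that image eventually along F, which
    forces the argument into V. *)
Lemma compact_cvg_unique_level (T U : topologicalType) (A : set T) (f : T -> U)
    (y0 : U) (p : T) (F : set_system T) (FF : Filter F) :
  hausdorff_space U -> compact A -> {within A, continuous f} ->
  (forall z, A z -> f z = y0 -> z = p) ->
  F A -> f @ F --> y0 -> F --> p.
Proof.
move=> hU cA cf fp FA fy0 O; rewrite nbhsE => -[V [oV Vp] VO].
have cAV : compact (A `&` ~` V).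
  by apply: compact_closedI cA _; exact: open_closedC.
have clfAV : closed (f @` (A `&` ~` V)).
  apply: compact_closed hU _; apply: continuous_compact cAV.
  by apply: continuous_subspaceW cf => z [].
have : nbhs y0 (~` (f @` (A `&` ~` V))).
  apply: open_nbhs_nbhs; split; first exact: closed_openC.
  by move=> [z [Az nVz] fz]; apply: nVz; rewrite (fp z Az fz).
move=> /fy0; rewrite nbhs_filterE /= => FV.
apply: filterS (filterI FA FV) => z [Az nfz].
by apply: VO; apply: contrapT => nVz; apply: nfz; exists z.
Qed.

Lemma bounded_series_cvg0 (R : realType) (a : nat -> R) (B : R) :
  (forall n, 0 <= a n) -> (forall n, \sum_(0 <= k < n) a k <= B) ->
  a n @[n --> \oo] --> (0 : R).
Proof.
move=> a0 aB; apply: (@cvg_series_cvg_0 R R).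
apply: nondecreasing_is_cvgn.
  by apply/nondecreasing_seqP => n; rewrite /series/= big_nat_recr//= lerDl.
by exists B => _ [n _ <-]; exact: aB.
Qed.

(** * Robust safety *)

(** The level s = delta is a candidate in the infimum that defines CVaR, and the
    excess over it is identically 0: off W the loss is replaced by 0, which is
    below delta. *)
Lemma worst_cvar_le_delta (R : realType) (nx nu nw : nat)
    (pb : mpc_problem R nx nu nw) (D : set (probability (borel_rV R nw) R))
    (y : 'rV[R]_nx) :
  (forall w, supW pb w -> risk pb y w <= delta pb) ->
  (worst_cvar pb D y <= (delta pb)%:E)%E.
Proof.
move=> safe; apply/ereal_supP => _ [mu _ <-].
apply: ge_ereal_inf; exists (delta pb)%:E => //; exists (delta pb) => //=.
rewrite (_ : (fun _ => _) = cst 0) ?expectation_cst ?mule0 ?adde0//.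
apply/funext => w; apply/max_idPr; rewrite subr_le0 patchE.
by case: ifPn => [|_]; [rewrite inE => /safe|exact/ltW/delta_gt0].
Qed.

(** * Completed trajectories *)

(** Both the initial trajectory and the completed iterations have this form,
    once prolonged by x_F with zero inputs. *)
Record completed_trajectory (R : realType) (nx nu nw : nat)
    (pb : mpc_problem R nx nu nw) (x : nat -> 'rV[R]_nx)
    (u : nat -> 'rV[R]_nu) (T : nat) : Prop := CompletedTrajectory {
  completed_dyn : forall t, x t.+1 = dyn pb (x t) (u t);
  completed_stX : forall t, stX pb (x t);
  completed_inU : forall t, inU pb (u t);
  completed_end : forall t, (T <= t)%N -> x t = xF pb /\ u t = 0
}.

(** The stage cost vanishes from time T on, so the partial sums are eventually
    constant. *)
Lemma cost_to_goE (R : realType) (nx nu nw : nat)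
    (pb : mpc_problem R nx nu nw) x u T t N :
  completed_trajectory pb x u T -> (T <= N)%N -> (t <= N)%N ->
  cost_to_go pb x u t = \sum_(t <= k < N) cost pb (x k) (u k).
Proof.
move=> c TN tN; apply: lim_near_cst; first exact: norm_hausdorff.
exists N => // n /= Nn; rewrite (big_cat_nat tN Nn)/=.
rewrite [X in _ + X]big_nat_cond [X in _ + X]big1 ?addr0// => k /andP[/andP[Nk _] _].
by have [-> ->] := completed_end c (leq_trans TN Nk); rewrite cost_xF.
Qed.

Lemma cost_to_goS (R : realType) (nx nu nw : nat)
    (pb : mpc_problem R nx nu nw) x u T t :
  completed_trajectory pb x u T ->
  cost_to_go pb x u t = cost pb (x t) (u t) + cost_to_go pb x u t.+1.
Proof.
move=> c; rewrite (cost_to_goE (N := maxn T t.+1) c) ?leq_max ?leqnn ?leqnSn ?orbT//.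
rewrite big_ltn ?leq_max ?leqnn ?orbT//.
by rewrite (cost_to_goE (t := t.+1) (N := maxn T t.+1) c) ?leq_max ?leqnn ?orbT.
Qed.

Lemma cost_to_go_ge0 (R : realType) (nx nu nw : nat)
    (pb : mpc_problem R nx nu nw) x u T t :
  completed_trajectory pb x u T -> 0 <= cost_to_go pb x u t.
Proof.
move=> c; rewrite (cost_to_goE (N := maxn T t) c) ?leq_max ?leqnn ?orbT//.
apply: sumr_ge0 => k _; apply: cost_ge0;
  [exact: completed_stX c _|exact: completed_inU c _].
Qed.

(** The initial safe set records a trajectory from time a = 0, a completed
    iteration from a = 1. *)
Definition trajectory_triples (R : realType) (nx nu nw : nat)
    (pb : mpc_problem R nx nu nw) (i : nat) x u (a T : nat) : set (triple R nx) :=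
  [set (i, x t, cost_to_go pb x u t) | t in [set t | (a <= t <= T)%N]].

Definition successor_closed (R : realType) (nx nu nw : nat)
    (pb : mpc_problem R nx nu nw) (S : set (triple R nx)) : Prop :=
  forall i y J, S (i, y, J) -> exists v J',
    [/\ inU pb v, S (i, dyn pb y v, J') & J = cost pb y v + J'].

Lemma trajectory_triples_sampled (R : realType) (nx nu nw : nat)
    (pb : mpc_problem R nx nu nw) i x u a T :
  completed_trajectory pb x u T ->
  sampled_safe_set pb (trajectory_triples pb i x u a T).
Proof.
move=> c; split.
  apply: finite_image; apply: sub_finite_set (finite_II T.+1) => t /=.
  by rewrite ltnS => /andP[].
move=> _ _ _ [t _ [_ <- <-]].
by split; [exact: completed_stX c _|exact: cost_to_go_ge0 c].
Qed.

(** The successor of the triple at time t is the one at t.+1, except that the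
    last triple is its own successor, as x_F is an equilibrium of zero cost. *)
Lemma trajectory_triples_successor (R : realType) (nx nu nw : nat)
    (pb : mpc_problem R nx nu nw) i x u a T :
  completed_trajectory pb x u T ->
  successor_closed pb (trajectory_triples pb i x u a T).
Proof.
move=> c _ _ _ [t /= /andP[at_ tT] [<- <- <-]].
exists (u t), (cost_to_go pb x u t.+1); split.
- exact: completed_inU c _.
- rewrite -(completed_dyn c); move: tT; rewrite leq_eqVlt => /predU1P[tT|tT].
    exists T; first by rewrite -tT/= at_ leqnn.
    have [xT uT] := completed_end c (leqnn T).
    have [xT1 _] := completed_end c (leqnSn T).
    by rewrite tT xT1 -xT (cost_to_goS T c) xT uT cost_xF add0r.
  by exists t.+1 => //=; rewrite tT (leq_trans at_).
- exact: cost_to_goS c.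
Qed.

(** * The value of the finite-horizon problem *)

Record safe_and_closed (R : realType) (nx nu nw : nat)
    (pb : mpc_problem R nx nu nw) (D : set (probability (borel_rV R nw) R))
    (S : set (triple R nx)) : Prop := SafeAndClosed {
  sac_sampled : sampled_safe_set pb S;
  sac_safe : forall y, states S y -> (worst_cvar pb D y <= (delta pb)%:E)%E;
  sac_succ : successor_closed pb S
}.

(** An infimum, so that it makes sense without assuming an optimizer; the value
    is +oo when the problem is infeasible. *)
Definition fh_value (R : realType) (nx nu nw : nat)
    (pb : mpc_problem R nx nu nw) (S : set (triple R nx))
    (D : set (probability (borel_rV R nw) R)) (y : 'rV[R]_nx) : \bar R :=
  ereal_inf [set fh_cost pb S z.1 z.2
            | z in [set z | fh_feasible pb y S D z.1 z.2]].

Lemma fh_value_ge0 (R : realType) (nx nu nw : nat)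
    (pb : mpc_problem R nx nu nw) S D y :
  sampled_safe_set pb S -> (0 <= fh_value pb S D y)%E.
Proof.
move=> [_ S0]; apply/ereal_infP => _ [[xs us]/= [_ step _] <-].
apply: adde_ge0.
  rewrite lee_fin big_nat; apply: sumr_ge0 => k /andP[_ kK].
  by have [_ ? ? _] := step k kK; exact: cost_ge0.
by apply/ereal_infP => _ [J [i /S0[_ J0]] <-]; rewrite lee_fin.
Qed.

Lemma fh_value_lt_pinfty (R : realType) (nx nu nw : nat)
    (pb : mpc_problem R nx nu nw) S D y xs us :
  fh_feasible pb y S D xs us -> (fh_value pb S D y < +oo)%E.
Proof.
move=> feas; have [_ _ [i [J SJ]]] := feas.
apply: (@le_lt_trans _ _ (fh_cost pb S xs us)).
  by apply: ge_ereal_inf; exists (fh_cost pb S xs us) => //; exists (xs, us).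
apply: (@le_lt_trans _ _
  ((\sum_(0 <= k < horizon pb) cost pb (xs k) (us k))%:E + J%:E)%E).
  rewrite /fh_cost leeD2l//; apply: ge_ereal_inf.
  by exists J%:E => //; exists J => //; exists i.
exact: ltry.
Qed.

(** Drop the first step and append the input that S attaches to the terminal
    triple.  The total cost is unchanged because J = cost + J' at that triple.
    The terminal state becomes an intermediate one, and it satisfies the state
    and risk constraints because it belongs to S. *)
Lemma fh_shift (R : realType) (nx nu nw : nat)
    (pb : mpc_problem R nx nu nw) S D y xs us i J :
  safe_and_closed pb D S -> fh_feasible pb y S D xs us ->
  S (i, xs (horizon pb), J) ->
  exists xs' us' J',
    [/\ fh_feasible pb (dyn pb y (us 0%N)) S D xs' us',
        S (i, xs' (horizon pb), J') &
        cost pb y (us 0%N) +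
          (\sum_(0 <= k < horizon pb) cost pb (xs' k) (us' k) + J') =
        \sum_(0 <= k < horizon pb) cost pb (xs k) (us k) + J].
Proof.
move=> [[_ SX] Ssafe Ssucc] [xs0 step _] SJ.
have [v [J' [Uv SJ' ->]]] := Ssucc _ _ _ SJ.
have [XK _] := SX _ _ _ SJ.
have cK := Ssafe _ (ex_intro _ i (ex_intro _ J SJ)).
move: step SJ SJ' XK cK (horizon_gt0 pb); rewrite /fh_feasible.
case: (horizon pb) => // K step SJ SJ' XK cK _.
pose xs' k := if (k < K.+1)%N then xs k.+1 else dyn pb (xs K.+1) v.
pose us' k := if (k < K)%N then us k.+1 else v.
have xs'K : xs' K.+1 = dyn pb (xs K.+1) v by rewrite /xs' ltnn.
exists xs', us', J'; split; [split|by rewrite xs'K|].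
- have [xs1 _ _ _] := step 0%N isT.
  by rewrite /xs' /= xs1 xs0.
- move=> k; rewrite ltnS leq_eqVlt => /predU1P[->|kK].
    (* the appended step, from the former terminal state *)
    by rewrite xs'K /xs' /us' ltnn ltnSn.
  rewrite /xs' /us' ltnS kK ltnS (ltnW kK).
  exact: step.
- by exists i, J'; rewrite xs'K.
- rewrite big_nat_recr//= [in RHS]big_nat_recl//= xs0 -!addrA; congr (_ + _).
  rewrite {2}/xs' {2}/us' ltnSn ltnn; congr (_ + _).
  apply: eq_big_nat => k /andP[_ kK].
  by rewrite /xs' /us' kK ltnS (ltnW kK).
Qed.

(** Each J in the infimum defining the terminal cost gives, by the shift, a
    feasible trajectory at the next state that is cheaper by the first stage
    cost; taking the infimum over J gives the bound. *)
Lemma fh_value_decrease (R : realType) (nx nu nw : nat)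
    (pb : mpc_problem R nx nu nw) S D y v :
  safe_and_closed pb D S -> fh_first_input pb y S D v ->
  ((cost pb y v)%:E + fh_value pb S D (dyn pb y v) <= fh_value pb S D y)%E.
Proof.
move=> sac [xs [us [[feas opt] <-]]].
apply: (@le_trans _ _ (fh_cost pb S xs us)); last first.
  by apply/ereal_infP => _ [[xs' us'] feas' <-]; exact: opt.
rewrite /fh_cost -leeBlDl//; apply/ereal_infP => _ [J [i SJ] <-].
rewrite leeBlDl// -EFinD.
have [xs' [us' [J' [feas' SJ' <-]]]] := fh_shift sac feas SJ.
rewrite EFinD leeD2l//; apply: ge_ereal_inf.
exists (fh_cost pb S xs' us'); first by exists (xs', us').
rewrite /fh_cost EFinD leeD2l//; apply: ge_ereal_inf.
by exists J'%:E => //; exists J' => //; exists i.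
Qed.

(** * Recursive feasibility and convergence of one run *)

(** Feasibility propagates from x_t to x_(t+1), which is the premise under which
    the routine is known to apply an optimal input.  Once x_t = x_F the state no
    longer moves and the stage cost is 0, so the conclusions hold there too and
    need no separate treatment of runs that terminate. *)
Lemma dr_mpc_step (R : realType) (nx nu nw : nat)
    (pb : mpc_problem R nx nu nw) S D x u t :
  fh_attained pb -> ambiguity_set (supW pb) D ->
  safe_and_closed pb D S -> dr_mpc pb S D x u ->
  (exists xs us, fh_feasible pb (x t) S D xs us) ->
  [/\ stX pb (x t), inU pb (u t),
      exists xs us, fh_feasible pb (x t.+1) S D xs us &
      ((cost pb (x t) (u t))%:E + fh_value pb S D (x t.+1)
        <= fh_value pb S D (x t))%E].
Proof.
move=> att amb sac [_ /(_ t)[xt1 xF_u opt_u]] ex_feas.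
have Xx : stX pb (x t).
  have [xs [us [<- step _]]] := ex_feas.
  by have [] := step 0%N (horizon_gt0 pb).
have [xtF|xtF] := pselect (x t = xF pb).
  have u0 := xF_u xtF.
  have xt1E : x t.+1 = x t by rewrite xt1 xtF u0 xF_equilibrium.
  split => //; first by rewrite u0; exact: zero_in.
    by rewrite xt1E.
  by rewrite xt1E xtF u0 cost_xF add0e.
have first_u : fh_first_input pb (x t) S D (u t).
  apply: opt_u => //.
  have [xs [us o]] := att _ _ _ Xx (sac_sampled sac) amb ex_feas.
  by exists (us 0%N), xs, us.
have dec := fh_value_decrease sac first_u; rewrite xt1; split => //.
  have [xs [us [[[_ step _] _] <-]]] := first_u.
  by have [] := step 0%N (horizon_gt0 pb).
have [xs [us [[feas _] <-]]] := first_u.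
have [_ _ [i [J SJ]]] := feas.
have [xs' [us' [J' [feas' _ _]]]] := fh_shift sac feas SJ.
by exists xs', us'.
Qed.

Lemma dr_mpc_feasible (R : realType) (nx nu nw : nat)
    (pb : mpc_problem R nx nu nw) S D x u t :
  fh_attained pb -> ambiguity_set (supW pb) D ->
  safe_and_closed pb D S -> dr_mpc pb S D x u ->
  (exists xs us, fh_feasible pb (xS pb) S D xs us) ->
  exists xs us, fh_feasible pb (x t) S D xs us.
Proof.
move=> att amb sac mpc; rewrite -(proj1 mpc) => feas0.
elim: t => [//|t IH].
by have [_ _ ? _] := dr_mpc_step att amb sac mpc IH.
Qed.

Lemma dr_mpc_cvg (R : realType) (nx nu nw : nat)
    (pb : mpc_problem R nx nu nw) S D x u :
  fh_attained pb -> ambiguity_set (supW pb) D ->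
  safe_and_closed pb D S -> dr_mpc pb S D x u ->
  (exists xs us, fh_feasible pb (xS pb) S D xs us) ->
  x t @[t --> \oo] --> xF pb.
Proof.
move=> att amb sac mpc feas0.
have feas t := dr_mpc_feasible t att amb sac mpc feas0.
have step t := dr_mpc_step att amb sac mpc (feas t).
have V_ge0 y : (0 <= fh_value pb S D y)%E := fh_value_ge0 D y (sac_sampled sac).
have V0_fin : fh_value pb S D (x 0%N) \is a fin_num.
  have [xs [us f]] := feas 0%N.
  by rewrite ge0_fin_numE//; exact: fh_value_lt_pinfty f.
have sum_le n : ((\sum_(0 <= k < n) cost pb (x k) (u k))%:E
    + fh_value pb S D (x n) <= fh_value pb S D (x 0%N))%E.
  elim: n => [|n IH]; first by rewrite big_nil add0e.
  apply: le_trans IH; rewrite big_nat_recr//= EFinD -addeA leeD2l//.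
  by have [] := step n.
have cost0 : cost pb (x t) (u t) @[t --> \oo] --> (0 : R).
  apply: (@bounded_series_cvg0 _ _ (fine (fh_value pb S D (x 0%N)))) => n.
    by have [? ? _ _] := step n; exact: cost_ge0.
  rewrite -lee_fin fineK//; apply: le_trans (sum_le n); exact: leeDl.
have cvg_xu : (x t, u t) @[t --> \oo] --> (xF pb, 0 : 'rV[R]_nu).
  apply: (@compact_cvg_unique_level _ R (stX pb `*` inU pb)
    (fun z => cost pb z.1 z.2) 0).
  - exact: norm_hausdorff.
  - by apply: compact_setX; [exact: stX_compact|exact: inU_compact].
  - exact: cost_continuous.
  - move=> [y v] /= [Xy Uv] c0; apply: contrapT => ne.
    by have := cost_gt0 Xy Uv ne; rewrite c0 ltxx.
  - by exists 0%N => // t _; have [] := step t.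
  - exact: cost0.
exact: (cvg_comp _ fst cvg_xu cvg_fst).
Qed.

(** * The sampled-safe-sets of the iterations *)

(** Index 0 is reserved for the initial trajectory: the triples of S0 are in S,
    and S has no other triple of index 0.  The second part keeps foreign states
    from triggering the deletion of the initial trajectory. *)
Definition retains_initial (R : realType) (nx : nat) (S0 S : set (triple R nx)) : Prop :=
  S0 `<=` S /\ forall y J, S (0%N, y, J) -> S0 (0%N, y, J).

(** Deletion acts on whole trajectory indices and successors keep their index, so
    a surviving triple has a surviving successor.  What survives is safe for D by
    the deletion rule, and index 0 survives because S0 is robustly safe. *)
Lemma safe_set_update (R : realType) (nx nu nw : nat)
    (pb : mpc_problem R nx nu nw) S0 S D i x u T :
  (forall k y J, S0 (k, y, J) -> k = 0%N) ->
  (forall y, states S0 y -> forall w, supW pb w -> risk pb y w <= delta pb) ->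
  retains_initial S0 S -> sampled_safe_set pb S -> successor_closed pb S ->
  (0 < i)%N -> completed_trajectory pb x u T ->
  let S' := delete_unsafe pb (add_trajectory pb S i x u T) D in
  safe_and_closed pb D S' /\ retains_initial S0 S'.
Proof.
move=> S0_idx S0_safe [S0S SS0] [Sfin SX] Ssucc i_gt0 c S'.
have [Tfin TX] := trajectory_triples_sampled i 1 c.
have Tsucc := @trajectory_triples_successor _ _ _ _ _ i _ _ 1 _ c.
split; first split.
- split.
    apply: (@sub_finite_set _ _ (add_trajectory pb S i x u T)).
      by move=> p [].
    by rewrite finite_setU.
  by move=> k y J [[/SX//|/TX//] _].
- move=> y [k [J [Sy safe]]]; rewrite leNgt; apply/negP => bad.
  by apply: safe; exists y, J.
- move=> k y J [Sy safe].
  suff [v [J' [Uv Sv JE]]] : exists v J', [/\ inU pb v,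
      add_trajectory pb S i x u T (k, dyn pb y v, J') & J = cost pb y v + J'].
    by exists v, J'; split.
  case: Sy => [/Ssucc|/Tsucc] [v [J' [Uv Sv JE]]].
    by exists v, J'; split => //; left.
  by exists v, J'; split => //; right.
have idx0 y J : add_trajectory pb S i x u T (0%N, y, J) -> S0 (0%N, y, J).
  by case=> [/SS0//|[t _ [i0]]]; rewrite i0 in i_gt0.
split.
  move=> [[k y] J] S0y; split; first by left; exact: S0S.
  rewrite /= (S0_idx _ _ _ S0y) => -[z [Jz [/idx0 S0z]]].
  rewrite ltNge worst_cvar_le_delta//; apply: S0_safe.
  by exists 0%N, Jz.
by move=> y J [/idx0].
Qed.

Lemma dr_mpc_completed (R : realType) (nx nu nw : nat)
    (pb : mpc_problem R nx nu nw) S D x u T :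
  fh_attained pb -> ambiguity_set (supW pb) D ->
  safe_and_closed pb D S -> dr_mpc pb S D x u ->
  (exists xs us, fh_feasible pb (xS pb) S D xs us) ->
  reaches_at pb x T -> completed_trajectory pb x u T.
Proof.
move=> att amb sac mpc feas0 [xT _].
have step t := dr_mpc_step att amb sac mpc
  (dr_mpc_feasible t att amb sac mpc feas0).
have dynx t : x t.+1 = dyn pb (x t) (u t) by have [] := proj2 mpc t.
split => [//|t|t|t Tt]; [by have [] := step t|by have [] := step t|].
suff xt : x t = xF pb by split => //; have [_ + _] := proj2 mpc t; apply.
elim: t Tt => [|t IH]; first by rewrite leqn0 => /eqP T0; rewrite T0 in xT.
rewrite leq_eqVlt => /predU1P[<-//|/IH xt].
have [_ /(_ xt) ut _] := proj2 mpc t.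
by rewrite dynx xt ut xF_equilibrium.
Qed.

Lemma initial_safe_setP (R : realType) (nx nu nw : nat)
    (pb : mpc_problem R nx nu nw) S0 : initial_safe_set pb S0 ->
  exists x u T, [/\ x 0%N = xS pb, completed_trajectory pb x u T,
    S0 = trajectory_triples pb 0 x u 0 T &
    forall y, states S0 y ->
      forall w, supW pb w -> risk pb y w <= delta pb].
Proof.
move=> [x [u [T [x0 dynx endx S0E safe]]]]; exists x, u, T; split => //.
  split => // t; have [tT|Tt] := ltnP t T.
  - by have [] := dynx t tT.
  - have [-> ->] := endx t Tt; have [-> _] := endx t.+1 (leqW Tt).
    by rewrite xF_equilibrium.
  - suff /safe[] : states S0 (x t) by [].
    by exists 0%N, (cost_to_go pb x u t); rewrite S0E; exists t => //=; exact: ltnW.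
  - by have [-> _] := endx t Tt; exact: xF_in.
  - by have [] := dynx t tT.
  - by have [_ ->] := endx t Tt; exact: zero_in.
by move=> y /safe[].
Qed.

(** Every state of the initial trajectory is recorded in S, so the first steps of
    this trajectory, whatever the horizon, are a feasible plan at x_S. *)
Lemma xS_feasible (R : realType) (nx nu nw : nat)
    (pb : mpc_problem R nx nu nw) S0 S D x u T :
  x 0%N = xS pb -> completed_trajectory pb x u T ->
  S0 = trajectory_triples pb 0 x u 0 T -> S0 `<=` S ->
  safe_and_closed pb D S -> exists xs us, fh_feasible pb (xS pb) S D xs us.
Proof.
move=> x0 c S0E S0S sac.
have Sx t : states S (x t).
  have [tT|Tt] := leqP t T.
    by exists 0%N, (cost_to_go pb x u t); apply: S0S; rewrite S0E; exists t.
  exists 0%N, (cost_to_go pb x u T); apply: S0S; rewrite S0E; exists T => //=.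
  by have [-> _] := completed_end c (leqnn T);
     have [-> _] := completed_end c (ltnW Tt).
exists x, u; split => // k _; split.
- exact: completed_dyn c _.
- exact: completed_stX c _.
- exact: completed_inU c _.
- exact: sac_safe sac _ (Sx k).
Qed.

Lemma iteration_safe_set (R : realType) (nx nu nw : nat)
    (pb : mpc_problem R nx nu nw) (xi : nat -> 'rV[R]_nw) m0 S0 j x u T m S i :
  fh_attained pb -> initial_safe_set pb S0 -> (forall k, supW pb (xi k)) ->
  dr_rc_iterative_mpc pb xi m0 S0 j x u T m S -> (i < j)%N ->
  safe_and_closed pb (ambig pb (mkseq xi (m i))) (S i) /\ retains_initial S0 (S i).
Proof.
move=> att /initial_safe_setP[x0 [u0 [T0 [x00 c0 S0E safe0]]]] Wxi run.
have amb n : ambiguity_set (supW pb) (ambig pb (mkseq xi n)).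
  by apply: ambigP => _ /mapP[k _ ->].
have S0_idx k y J : S0 (k, y, J) -> k = 0%N by rewrite S0E => -[t _ []].
elim: i => [_|i IH ij].
  have [_ ->] := run_init run; split; last by split.
  split; [rewrite S0E|by move=> y /safe0; exact: worst_cvar_le_delta|rewrite S0E].
    exact: trajectory_triples_sampled.
  exact: trajectory_triples_successor.
have [sac ret] := IH (ltnW ij).
have mpc := run_mpc run (i := i.+1) (ltnW ij).
have feas := xS_feasible x00 c0 S0E ret.1 sac.
have c := dr_mpc_completed att (amb _) sac mpc feas
  (run_length run (i := i.+1) ij).
rewrite (run_safe_set run (i := i.+1) ij).
by apply: safe_set_update => //; case: sac.
Qed.

Theorem propositionV2 (R : realType) (nx nu nw : nat)
    (pb : mpc_problem R nx nu nw) (Hattained : fh_attained pb)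
    (d : measure_display) (Omega : measurableType d) (P : probability Omega R)
    (w : Omega -> borel_rV R nw) (xi : nat -> Omega -> borel_rV R nw)
    (Hxi : iid_samples (supW pb) P w xi)
    (m0 : nat) (S0 : set (triple R nx)) (HS0 : initial_safe_set pb S0)
    (omega : Omega) (Homega : forall i, supW pb (xi i omega))
    (j : nat) (Hj : (1 <= j)%N)
    (x : nat -> nat -> 'rV[R]_nx) (u : nat -> nat -> 'rV[R]_nu)
    (T : nat -> nat) (m : nat -> nat) (S : nat -> set (triple R nx))
    (Hrun : dr_rc_iterative_mpc pb (fun i => xi i omega) m0 S0 j x u T m S) :
  x j t @[t --> \oo] --> xF pb.
Proof.
have jj : (j.-1 < j)%N by rewrite prednK.
have [sac [S0S _]] := iteration_safe_set Hattained HS0 Homega Hrun jj.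
have [x0 [u0 [T0 [x00 c0 S0E _]]]] := initial_safe_setP HS0.
apply: (dr_mpc_cvg Hattained _ sac (run_mpc Hrun (i := j) _)) => //.
- by apply: ambigP => _ /mapP[k _ ->].
- by rewrite Hj leqnn.
- exact: xS_feasible x00 c0 S0E S0S sac.
Qed.
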